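(* Fix an equation $(f,q,w)$ as in the context with $\prod_{i=0}^{N-1}(1/f_i)>0$. Let $\gamma\in(-\pi,0)\cup(0,\pi)$ and $K=(k_{ij})\in SL(2,\mathbb R)$ with $k_{11}-f_0k_{12}\neq0$. Let $\mathbf U_K=\begin{pmatrix}k_{11}&k_{12}&0&0\\0&0&1&0\end{pmatrix}$. For $M\in\{K,-K\}$ with entries $m_{ij}$, write $\lambda_j(M)$, $\lambda_j(-M)$, $\lambda_j(e^{i\gamma}M)$, $\lambda_j(\mathbf U_K)$ for the eigenvalues with boundary conditions $[M|-I]$, $[-M|-I]$, $[e^{i\gamma}M|-I]$, $\mathbf U_K$, and put $m_j=\min\{\lambda_j(M),\lambda_j(-M)\}$, $M_j=\max\{\lambda_j(M),\lambda_j(-M)\}$. If $m_{11}-f_0m_{12}>0$, then for every $0\le j\le N-1$: $\lambda_j(M)<\lambda_j(e^{i\gamma}M)<\lambda_j(-M)$ if $j$ is even and $\lambda_j(-M)<\lambda_j(e^{i\gamma}M)<\lambda_j(M)$ if $j$ is odd; and $M_j\le\lambda_j(\mathbf U_K)\le m_{j+1}$ for $0\le j\le N-2$.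
   Context: Let $N\ge2$ be an integer. An equation is given by real sequences $f=\{f_n\}_{n=0}^N$, $q=\{q_n\}_{n=1}^N$, $w=\{w_n\}_{n=1}^N$ with $f_n\neq0$, $w_n>0$; it is $-\nabla(f_n\Delta y_n)+q_ny_n=\lambda w_ny_n$, $1\le n\le N$, for $y=\{y_n\}_{n=0}^{N+1}$, $\Delta y_n=y_{n+1}-y_n$, $\nabla y_n=y_n-y_{n-1}$. A boundary condition $[A\,|\,B]$ (equivalently the $2\times4$ coefficient matrix $(A,B)$ of rank 2) is $A(y_0,f_0\Delta y_0)^T+B(y_N,f_N\Delta y_N)^T=0$; matrices differing by left multiplication by an invertible $2\times2$ complex matrix give the same condition (so $\mathbf U_{-K}=\mathbf U_K$). $SL(2,\mathbb R)$: real $2\times2$ matrices of determinant 1; $I$ the identity. Eigenvalues ($\lambda$ with a nontrivial solution) are real; multiplicity = dimension of the solution space; counted with multiplicity they are ordered $\lambda_0\le\lambda_1\le\cdots$. *)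

(* Defs.v *)
From mathcomp Require Import all_boot all_order all_algebra.
From mathcomp Require Import reals trigo complex.
Set Implicit Arguments. Unset Strict Implicit. Unset Printing Implicit Defensive.
Import Order.TTheory GRing.Theory Num.Theory.
Local Open Scope ring_scope.
Local Open Scope complex_scope.

(* A (complex) sequence y = (y_0, ..., y_{N+1}) is a row vector of length N+2;
   [yat y n] is y_n. *)
Definition yat (R : realType) (N : nat) (y : 'rV[R[i]]_(N.+2)) (n : nat) : R[i] :=
  y 0 (inord n).

Definition Dy (R : realType) (N : nat) (y : 'rV[R[i]]_(N.+2)) (n : nat) : R[i] :=
  yat y n.+1 - yat y n.

(* residual of  -nabla(f_n Delta y_n) + q_n y_n - lambda w_n y_n  at n (1 <= n <= N) *)
Definition sl_resid (R : realType) (N : nat) (f q w : nat -> R) (lam : R[i])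
  (y : 'rV[R[i]]_(N.+2)) (n : nat) : R[i] :=
  - ((f n)%:C * Dy y n - (f n.-1)%:C * Dy y n.-1)
  + (q n)%:C * yat y n - lam * (w n)%:C * yat y n.

Definition bvec (R : realType) (N : nat) (f : nat -> R) (y : 'rV[R[i]]_(N.+2))
  (n : nat) : 'cV[R[i]]_2 :=
  \col_(k < 2) (if k == 0 :> nat then yat y n else (f n)%:C * Dy y n).

Definition bc_resid (R : realType) (N : nat) (f : nat -> R) (A B : 'M[R[i]]_2)
  (y : 'rV[R[i]]_(N.+2)) : 'cV[R[i]]_2 :=
  A *m bvec f y 0 + B *m bvec f y N.

(* all residuals collected in one vector: entries 0..N-1 are the equations at
   n = 1..N, entries N, N+1 are the two rows of the boundary condition. *)
Definition resid (R : realType) (N : nat) (f q w : nat -> R) (A B : 'M[R[i]]_2)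
  (lam : R[i]) (y : 'rV[R[i]]_(N.+2)) : 'rV[R[i]]_(N.+2) :=
  \row_(j < N.+2) (if (j < N)%N then sl_resid f q w lam y j.+1
                   else bc_resid f A B y (inord (j - N)) 0).

Definition is_solution (R : realType) (N : nat) (f q w : nat -> R)
  (A B : 'M[R[i]]_2) (lam : R[i]) (y : 'rV[R[i]]_(N.+2)) : Prop :=
  resid f q w A B lam y = 0.

(* multiplicity of lam = dimension of the (complex) solution space
   {y | resid y = 0} = kernel of the linear map resid (as a matrix);
   it is 0 iff lam is not an eigenvalue. *)
Definition mult (R : realType) (N : nat) (f q w : nat -> R) (A B : 'M[R[i]]_2)
  (lam : R[i]) : nat :=
  \rank (kermx (lin1_mx (@resid R N f q w A B lam))).

(* s is the nondecreasing list of all eigenvalues of [A|B], each repeated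
   according to its multiplicity; then s`_j = lambda_j. *)
Definition ev_list (R : realType) (N : nat) (f q w : nat -> R) (A B : 'M[R[i]]_2)
  (s : seq R) : Prop :=
  sorted <=%R s /\
  forall z : R[i], count (fun x : R => x%:C == z) s = mult N f q w A B z.

Definition cmx (R : realType) (M : 'M[R]_2) : 'M[R[i]]_2 :=
  map_mx (fun x : R => x%:C) M.

Definition expi (R : realType) (g : R) : R[i] := (cos g)%:C + 'i * (sin g)%:C.

(* U_K = ( k11 k12 0 0 ; 0 0 1 0 ), i.e. A = (k11 k12; 0 0), B = (0 0; 1 0) *)
Definition UK_A (R : realType) (K : 'M[R]_2) : 'M[R[i]]_2 :=
  \matrix_(i < 2, j < 2) (if i == 0 :> nat then (K 0 j)%:C else 0).
Definition UK_B (R : realType) : 'M[R[i]]_2 :=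
  \matrix_(i < 2, j < 2) (if (i == 1 :> nat) && (j == 0 :> nat) then 1 else 0).

(* Main.v *)
From HB Require Import structures.
Require Import Defs.
From mathcomp Require Import all_boot all_order all_algebra.
From mathcomp Require Import perm sesquilinear spectral ring.
From mathcomp Require Import reals trigo complex.
Set Implicit Arguments. Unset Strict Implicit. Unset Printing Implicit Defensive.
Import Order.TTheory GRing.Theory Num.Theory.
Local Open Scope ring_scope.
Local Open Scope complex_scope.

(** The boundary condition [e^(i gamma) M | -I] determines y_0 and y_(N+1) from
    y_1 and y_N, because c = m_11 - f_0 m_12 is nonzero.  After symmetrising with the
    square roots of the weights, the eigenvalues are those of a Hermitian periodic
    Jacobi matrix H_z with z = e^(i gamma), whose corner entries are proportional to z
    and its conjugate; U_K gives the leading principal submatrix, which does not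
    depend on z.  Cauchy interlacing with this common submatrix yields the bounds by
    the eigenvalues of U_K, and shows that the j-th eigenvalue for one z never passes
    the (j+1)-st for another.  Expanding the determinant in the two corners,
    det (H_z - x) = g(x) - 2 k Re z with k > 0 independent of x and z, the sign of k
    being that of the product of the f_i.  So at a j-th eigenvalue for one z the
    characteristic polynomial for another z has the sign of the difference of the real
    parts, whereas strictly between its (j-1)-st and j-th roots it has sign (-1)^j;
    this forces the alternating order. *)

(** * Spectral decomposition of Hermitian matrices with sorted real eigenvalues *)

Lemma rank_diag_mx (F : fieldType) (n : nat) (d : 'rV[F]_n) :
  \rank (diag_mx d) = (\sum_(i < n) (d 0%R i != 0%R))%N.
Proof.
elim: n d => [|n IHn] d; first by rewrite big_ord0 flatmx0 mxrank0.
rewrite big_ord_recl; change 'rV[F]_(1 + n) in d.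
have -> : diag_mx d = block_mx (diag_mx (lsubmx d)) 0 0 (diag_mx (rsubmx d)).
  by rewrite -diag_mx_row hsubmxK.
have /= -> := rank_diag_block_mx (diag_mx (lsubmx d)) (diag_mx (rsubmx d)).
rewrite IHn; congr (_ + _)%N; last first.
  by apply: eq_bigr => i _; rewrite mxE rshift1.
have -> : diag_mx (lsubmx d) = (d 0 ord0)%:M.
  by rewrite [LHS]mx11_scalar !mxE eqxx mulr1n lshift0.
have [->|nz] := eqVneq; first by rewrite raddf0 mxrank0.
by rewrite -scalemx1 mxrank_scale_nz // mxrank1.
Qed.

Section HermitianSpectrum.
Variable R : rcfType.
Local Notation C := R[i].
Local Open Scope sesquilinear_scope.

Definition spec_diag (n : nat) (s : seq R) : 'rV[C]_n := \row_i (s`_i)%:C.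

(** The spectral theorem yields the eigenvalues as real-valued complex numbers in no particular
    order. Their real parts are sorted, and the rows of the unitary matrix are permuted along. *)
Lemma hermitian_spectrum (n : nat) (S : 'M[C]_n) :
  (forall i j, S i j = Num.conj (S j i)) ->
  exists s (U : 'M[C]_n), [/\ sorted <=%R s, size s = n, U \is unitarymx &
    S = U ^t* *m diag_mx (spec_diag n s) *m U].
Proof.
move=> herm.
have hS : S \is hermsymmx.
  apply/is_hermitianmxP; rewrite expr0 scale1r.
  by apply/matrixP => i j; rewrite !mxE.
have /orthomx_spectralP := hermitian_normalmx hS.
have /mxOverP dreal := hermitian_spectral_diag_real hS.
have Uu := spectral_unitarymx S.
set V := spectralmx S in Uu *; set d := spectral_diag S in dreal *.
rewrite invmx_unitary // => eS.
pose t : n.-tuple R := [tuple complex.Re (d 0 i) | i < n].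
have /tuple_permP[p ep] : perm_eq (sort <=%R t) t by rewrite perm_sort.
exists (sort <=%R t), (\matrix_i row (p i) V); split.
- exact: sort_le_sorted.
- by rewrite size_sort size_tuple.
- apply/unitarymxP/matrixP => i j; move/unitarymxP/matrixP/(_ (p i) (p j)): Uu.
  rewrite !mxE (inj_eq perm_inj) => <-.
  by apply: eq_bigr => k _; rewrite !mxE.
rewrite {1}eS; apply/matrixP => i j; rewrite !mul_mx_diag !mxE.
rewrite (reindex_perm p) /=; apply: eq_bigr => k _; rewrite !mxE ep.
rewrite nth_mktuple tnth_mktuple RRe_real //.
Qed.
Section Decomposition.
Variables (n : nat) (S U : 'M[C]_n) (s : seq R).
Hypothesis s_size : size s = n.
Hypothesis Uu : U \is unitarymx.
Hypothesis eS : S = U ^t* *m diag_mx (spec_diag n s) *m U.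

Lemma sub_scalar_spectrum (z : C) :
  S - z%:M = U ^t* *m diag_mx (spec_diag n s - const_mx z) *m U.
Proof.
rewrite linearB /= diag_const_mx mulmxBr mulmxBl -eS; congr (_ - _).
by rewrite mul_mx_scalar -scalemxAl -invmx_unitary // mulVmx ?unitarymx_unit // scalemx1.
Qed.

Lemma count_spectrum (z : C) :
  count (fun x : R => x%:C == z) s = \rank (kermx (S - z%:M)).
Proof.
have Uunit := unitarymx_unit Uu.
rewrite sub_scalar_spectrum mxrank_ker -invmx_unitary //.
rewrite mxrankMfree ?row_free_unit //.
rewrite (eqmxMfull _ (_ : row_full (invmx U))) ?row_full_unit ?unitmx_inv //.
rewrite rank_diag_mx -sum1_count big_mkcond (big_nth 0) s_size big_mkord /=.
(* Each index either has [s_i = z] or gives a nonzero diagonal entry, so the count and the rank add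
   up to [n]. *)
apply/esym/(canLR (addnK _)).
rewrite -big_split /= -[LHS]card_ord -sum1_card; apply: eq_bigr => i _.
by rewrite !mxE subr_eq0; case: eqP.
Qed.

Lemma det_spectrum (z : C) : \det (S - z%:M) = \prod_(i < n) ((s`_i)%:C - z).
Proof.
rewrite sub_scalar_spectrum !det_mulmx mulrAC -det_mulmx -invmx_unitary //.
rewrite mulVmx ?unitarymx_unit // det1 mul1r det_diag.
by apply: eq_bigr => i _; rewrite !mxE.
Qed.

Lemma spectrum_form (v : 'rV[C]_n) : (v *m S *m v ^t*) 0 0 =
  \sum_(i < n) (s`_i)%:C * `|(v *m U ^t*) 0 i| ^+ 2.
Proof.
set c := v *m U^t*.
have cE : U *m v ^t* = c ^t* by rewrite trmx_mul map_mxM trmxCK.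
rewrite eS !mulmxA -/c -mulmxA cE mul_mx_diag mxE; apply: eq_bigr => i _.
by rewrite !mxE mulrAC -normCK mulrC.
Qed.

Lemma spectrum_norm (v : 'rV[C]_n) :
  (v *m v ^t*) 0 0 = \sum_i `|(v *m U ^t*) 0 i| ^+ 2.
Proof.
set c := v *m U^t*.
have cE : U *m v ^t* = c ^t* by rewrite trmx_mul map_mxM trmxCK.
rewrite -[X in X *m _]mulmx1 -(mulVmx (unitarymx_unit Uu)) invmx_unitary //.
rewrite mulmxA -/c -mulmxA cE mxE; apply: eq_bigr => i _.
by rewrite !mxE -normCK.
Qed.

(** The rows of [U] are orthonormal eigenvectors, and only those along which [v] has a nonzero
    coordinate enter its Rayleigh quotient. *)
Lemma spectrum_form_ge (a : R) (v : 'rV[C]_n) :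
  (forall i : 'I_n, (v *m U ^t*) 0 i != 0 -> a <= s`_i) ->
  a%:C * (v *m v ^t*) 0 0 <= (v *m S *m v ^t*) 0 0.
Proof.
move=> a_le; rewrite spectrum_form spectrum_norm mulr_sumr.
apply: ler_sum => i _; have [->|/a_le le_a] := eqVneq ((v *m U^t*) 0 i) 0.
  by rewrite normr0 expr0n !mulr0.
by rewrite ler_wpM2r ?lecR // exprn_ge0.
Qed.

Lemma spectrum_form_le (a : R) (v : 'rV[C]_n) :
  (forall i : 'I_n, (v *m U ^t*) 0 i != 0 -> s`_i <= a) ->
  (v *m S *m v ^t*) 0 0 <= a%:C * (v *m v ^t*) 0 0.
Proof.
move=> a_ge; rewrite spectrum_form spectrum_norm mulr_sumr.
apply: ler_sum => i _; have [->|/a_ge ge_a] := eqVneq ((v *m U^t*) 0 i) 0.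
  by rewrite normr0 expr0n !mulr0.
by rewrite ler_wpM2r ?lecR // exprn_ge0.
Qed.
End Decomposition.

(** * Cauchy interlacing for a leading principal submatrix *)

Lemma sqnorm_gt0 (n : nat) (v : 'rV[C]_n) : v != 0 -> 0 < (v *m v ^t*) 0 0.
Proof.
move=> v_neq0; have [k vk] : exists k, v 0 k != 0 by apply/rV0Pn.
rewrite mxE (bigD1 k) //= ltr_wpDr //.
  by apply: sumr_ge0 => i _; rewrite !mxE mul_conjC_ge0.
by rewrite !mxE mul_conjC_gt0.
Qed.

Lemma kernel_nontrivial (F : fieldType) (n : nat) (A : 'M[F]_(n.+1, n)) :
  exists2 v : 'rV_n.+1, v != 0 & v *m A = 0.
Proof.
have : kermx A != 0.
  by rewrite -mxrank_eq0 mxrank_ker subn_eq0 -ltnNge ltnS rank_leq_col.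
by move=> /rowV0Pn[v /sub_kermxP vA v_neq0]; exists v.
Qed.

Section Interlacing.
Variables (n : nat) (S U : 'M[C]_n.+1) (S' U' : 'M[C]_n) (s s' : seq R).
Hypothesis s_size : size s = n.+1.
Hypothesis s'_size : size s' = n.
Hypothesis s_sorted : sorted <=%R s.
Hypothesis s'_sorted : sorted <=%R s'.
Hypothesis Uu : U \is unitarymx.
Hypothesis U'u : U' \is unitarymx.
Hypothesis eS : S = U ^t* *m diag_mx (spec_diag n.+1 s) *m U.
Hypothesis eS' : S' = U' ^t* *m diag_mx (spec_diag n s') *m U'.
Let wid : 'I_n -> 'I_n.+1 := widen_ord (leqnSn n).
Hypothesis S'_sub : forall i j, S' i j = S (wid i) (wid j).

Let trunc (v : 'rV[C]_n.+1) : 'rV[C]_n := \row_i v 0 (wid i).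

Lemma trunc_form (v : 'rV[C]_n.+1) : v 0 ord_max = 0 ->
  (trunc v *m S' *m (trunc v) ^t*) 0 0 = (v *m S *m v ^t*) 0 0.
Proof.
move=> v0; have v0' : (v ^t*) ord_max 0 = 0 by rewrite !mxE v0 rmorph0.
rewrite !mxE big_ord_recr /= v0' mulr0 addr0.
apply: eq_bigr => i _; rewrite !mxE; congr (_ * _).
rewrite big_ord_recr /= v0 mul0r addr0.
by apply: eq_bigr => j _; rewrite !mxE S'_sub.
Qed.

Lemma trunc_norm (v : 'rV[C]_n.+1) : v 0 ord_max = 0 ->
  (trunc v *m (trunc v) ^t*) 0 0 = (v *m v ^t*) 0 0.
Proof.
move=> v0; rewrite !mxE big_ord_recr /= v0 mul0r addr0.
by apply: eq_bigr => i _; rewrite !mxE.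
Qed.

(** Truncation as a matrix turns conditions on the truncated vector into linear conditions on
    [v]. *)
Let P : 'M[C]_(n.+1, n) := \matrix_(i, j) (i == wid j)%:R.

Lemma truncE (v : 'rV[C]_n.+1) : trunc v = v *m P.
Proof.
apply/rowP => j; rewrite !mxE (bigD1 (wid j)) //= mxE eqxx mulr1 big1 ?addr0 //.
by move=> i /negPf ne_ij; rewrite mxE ne_ij mulr0.
Qed.

(* The three families impose j + 1 + (n - 1 - j) = n linear conditions on n + 1 unknowns. *)
Lemma interlacing_vector (j : 'I_n) (A B : 'M[C]_(n.+1, n)) :
  exists v : 'rV[C]_n.+1, [/\ v != 0, v 0 ord_max = 0,
    forall k : 'I_n, (k < j)%N -> (v *m A) 0 k = 0 &
    forall k : 'I_n, (j < k)%N -> (v *m B) 0 k = 0].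
Proof.
pose Z : 'M[C]_(n.+1, n) := \matrix_(i, k)
  if (k < j)%N then A i k else if k == j then (i == ord_max)%:R else B i k.
have [v v_neq0 vZ] := kernel_nontrivial Z; exists v; split => //.
- have /rowP/(_ j) := vZ; rewrite !mxE (bigD1 ord_max) //=.
  rewrite big1 => [|i /negPf i_max]; rewrite mxE ltnn eqxx ?i_max ?mulr0 //.
  by rewrite eqxx mulr1 addr0.
- move=> k lt_kj; have /rowP/(_ k) := vZ; rewrite !mxE => vZk; rewrite -[RHS]vZk.
  by apply: eq_bigr => i _; rewrite mxE lt_kj.
- move=> k lt_jk; have /rowP/(_ k) := vZ; rewrite !mxE => vZk; rewrite -[RHS]vZk.
  apply: eq_bigr => i _; rewrite mxE ltnNge (ltnW lt_jk) /=.
  by rewrite -val_eqE /= gtn_eqF.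
Qed.

(** One test vector suffices: [v] is orthogonal to the first [j] eigenvectors of [S], and its
    truncation to those of [S'] beyond [j]. As the last coordinate of [v] is 0, both Rayleigh
    quotients agree. *)
Lemma cauchy_interlacing_lower (j : nat) : (j < n)%N -> s`_j <= s'`_j.
Proof.
move=> lt_jn; pose jo := Ordinal lt_jn.
have [v [v_neq0 v0 vA vB]] := interlacing_vector jo
  (\matrix_(i, k) (U ^t*) i (wid k)) (P *m U' ^t*).
have v_gt0 := sqnorm_gt0 v_neq0.
rewrite -lecR -(ler_pM2r v_gt0).
apply: (@le_trans _ _ ((v *m S *m v ^t*) 0 0)).
  apply: (spectrum_form_ge Uu eS) => i vi.
  apply: (sorted_leq_nth le_trans le_refl) => //; rewrite ?inE ?s_size ?ltn_ord //.
    by rewrite ltnS ltnW.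
  rewrite leqNgt; apply: contra vi => lt_ij.
  have lt_in : (i < n)%N := ltn_trans lt_ij lt_jn.
  rewrite -(vA (Ordinal lt_in)) // !mxE; apply/eqP/eq_bigr => k _.
  by rewrite [in RHS]mxE; congr (_ * (_ ^t*) _ _); apply: val_inj.
rewrite -trunc_form // -trunc_norm //; apply: (spectrum_form_le U'u eS') => i vi.
apply: (sorted_leq_nth le_trans le_refl) => //; rewrite ?inE ?s'_size ?ltn_ord //.
rewrite leqNgt; apply: contra vi => lt_ji.
by rewrite truncE -mulmxA vB.
Qed.

Lemma cauchy_interlacing_upper (j : nat) : (j < n)%N -> s'`_j <= s`_j.+1.
Proof.
move=> lt_jn; pose jo := Ordinal lt_jn.
(* The roles are exchanged. Through [lift ord0], condition [k] concerns eigenvector [k + 1] of [S],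
   so those beyond [j + 1] are excluded. *)
have [v [v_neq0 v0 vA vB]] := interlacing_vector jo (P *m U' ^t*)
  (\matrix_(i, k) (U ^t*) i (lift ord0 k)).
have v_gt0 := sqnorm_gt0 v_neq0.
rewrite -lecR -(ler_pM2r v_gt0).
apply: (@le_trans _ _ ((v *m S *m v ^t*) 0 0)); last first.
  apply: (spectrum_form_le Uu eS) => i vi.
  apply: (sorted_leq_nth le_trans le_refl) => //; rewrite ?inE ?s_size ?ltn_ord //.
  rewrite leqNgt; apply: contra vi => lt_ij.
  have lt_in : (i.-1 < n)%N by case: i lt_ij => -[].
  have lt_ji : (j < i.-1)%N by case: i lt_ij lt_in => -[].
  rewrite -(vB (Ordinal lt_in)) // !mxE; apply/eqP/eq_bigr => k _.
  rewrite [in RHS]mxE; congr (_ * (_ ^t*) _ _); apply: val_inj => /=.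
  by rewrite /bump /= add1n; case: i lt_ij {lt_in lt_ji} => -[].
rewrite -trunc_form // -trunc_norm //; apply: (spectrum_form_ge U'u eS') => i vi.
apply: (sorted_leq_nth le_trans le_refl) => //; rewrite ?inE ?s'_size ?ltn_ord //.
rewrite leqNgt; apply: contra vi => lt_ji.
by rewrite truncE -mulmxA vA.
Qed.
End Interlacing.

End HermitianSpectrum.

(** * Determinant of a periodic Jacobi matrix as a function of its two corners *)

Lemma det_add_delta (A : comNzRingType) (n : nat) (B : 'M[A]_n) i j x :
  \det (B + x *: delta_mx i j) = \det B + x * cofactor B i j.
Proof.
rewrite !(expand_det_row _ i).
(* Cofactors along row [i] omit that row, hence do not see the perturbed entry. *)
have cofE k : cofactor (B + x *: delta_mx i j) i k = cofactor B i k.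
  rewrite /cofactor; congr (_ * \det _); apply/matrixP => a b.
  by rewrite !mxE eq_sym (negPf (neq_lift i a)) mulr0 addr0.
under eq_bigr do rewrite cofE !mxE eqxx /= mulrDl.
rewrite big_split /=; congr (_ + _); rewrite (bigD1 j) //= eqxx mulr1 big1 ?addr0 //.
by move=> k /negPf ->; rewrite mulr0 mul0r.
Qed.

Section PeriodicJacobi.
Variables (A : comNzRingType) (n : nat) (T : 'M[A]_n.+2).
Hypothesis T_sym : forall i j, T i j = T j i.
Hypothesis T_band : forall i j : 'I_n.+2, (i.+1 < j)%N -> T i j = 0.

Definition offdiag_prod : A :=
  \prod_(i < n.+1) - T (widen_ord (leqnSn n.+1) i) (lift ord0 i).

(** Without its last row and first column the matrix is lower triangular, with the old superdiagonal
    on its diagonal. The cofactor sign is absorbed by the minus signs in [offdiag_prod]. *)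
Lemma cofactor_corner : cofactor T ord_max ord0 = offdiag_prod.
Proof.
rewrite /cofactor det_trig; last first.
  apply/is_trig_mxP => i j lt_ij; rewrite !mxE T_band //=.
  by rewrite /bump leq0n [(n.+1 <= i)%N]leqNgt ltn_ord add0n add1n ltnS.
rewrite addn0 /offdiag_prod prodrN card_ord; congr (_ * _).
apply: eq_bigr => i _; rewrite !mxE; congr (T _ _); apply: val_inj.
by rewrite /= /bump [(n.+1 <= i)%N]leqNgt ltn_ord add0n.
Qed.

Lemma cofactor_corner_tr : cofactor T ord0 ord_max = offdiag_prod.
Proof.
rewrite -cofactor_corner -cofactor_tr; congr (cofactor _ _ _).
by apply/matrixP => i j; rewrite mxE T_sym.
Qed.

(** The corners are added one at a time, and the cofactor met by the second is affine in the first.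
    Later [x * y], the factor of [e], is the same for all [z] of modulus 1. *)
Lemma det_periodic_jacobi : exists e : A, forall x y : A,
  \det (T + x *: delta_mx ord_max ord0 + y *: delta_mx ord0 ord_max) =
  \det T + (x + y) * offdiag_prod + x * y * e.
Proof.
pose B := row' ord0 (col' ord_max T).
exists ((-1) ^+ n.+1 * cofactor B ord_max ord0) => x y.
rewrite !det_add_delta cofactor_corner.
have -> : cofactor (T + x *: delta_mx ord_max ord0) ord0 ord_max =
    offdiag_prod + x * ((-1) ^+ n.+1 * cofactor B ord_max ord0).
  rewrite -cofactor_corner_tr {1 2}/cofactor /= add0n mulrCA -mulrDr; congr (_ * _).
  rewrite -det_add_delta; congr (\det _); apply/matrixP => i j; rewrite !mxE.
  congr (_ + _ * _%:R); rewrite -!val_eqE /= /bump leq0n add1n eqSS.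
  by rewrite leqNgt ltn_ord add0n.
by rewrite mulrDr mulrDl !addrA mulrA [y * x]mulrC.
Qed.

End PeriodicJacobi.

(** * Signs between sorted roots and the alternating order of two root lists *)

Section Ordering.
Variable R : realDomainType.

(** The [j] factors before index [j] are nonpositive, the others nonnegative. The guard [0 < j] lets
    [j = 0] pass with no lower bound on [x]. *)
Lemma sign_between_roots (n j : nat) (s : seq R) (x : R) :
  sorted <=%R s -> size s = n -> (j < n)%N ->
  ((0 < j)%N -> s`_j.-1 <= x) -> x <= s`_j ->
  0 <= (-1) ^+ j * \prod_(i < n) (s`_i - x).
Proof.
move=> s_sorted s_size lt_jn le_x ge_x.
have mono := sorted_leq_nth le_trans le_refl 0 s_sorted.
rewrite -(big_mkord xpredT (fun i => s`_i - x)) (big_cat_nat (leq0n j) (ltnW lt_jn)) /=.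
rewrite mulrA mulr_ge0 //; last first.
  rewrite big_nat_cond; apply: prodr_ge0 => i /andP[/andP[le_ji lt_in] _].
  by rewrite subr_ge0 (le_trans ge_x) // mono // inE s_size.
rewrite big_mkord; under eq_bigr do rewrite -opprB.
rewrite prodrN card_ord mulrA -expr2 sqrr_sign mul1r; apply: prodr_ge0 => i _.
have lt_ij := ltn_ord i.
rewrite subr_ge0 (le_trans _ (le_x _)) // ?(leq_ltn_trans _ lt_ij) //.
apply: mono; rewrite ?inE ?s_size.
- exact: ltn_trans lt_ij lt_jn.
- exact: leq_ltn_trans (leq_pred _) lt_jn.
- by rewrite -ltnS prednK // (leq_ltn_trans _ lt_ij).
Qed.

(** If the order failed at [j], the [j]-th root of one list would lie between the roots [j - 1] and
    [j] of the other. The other product would there have weak sign [(-1) ^+ j], whereas the shift by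
    [d] makes it strictly of the opposite sign. *)
Lemma alternating_roots (n : nat) (s t : seq R) (d : R) :
  sorted <=%R s -> size s = n -> sorted <=%R t -> size t = n -> 0 < d ->
  (forall x, \prod_(i < n) (s`_i - x) = \prod_(i < n) (t`_i - x) + d) ->
  (forall j, (j.+1 < n)%N -> s`_j <= t`_j.+1) ->
  (forall j, (j.+1 < n)%N -> t`_j <= s`_j.+1) ->
  forall j, (j < n)%N -> if ~~ odd j then t`_j < s`_j else s`_j < t`_j.
Proof.
move=> s_sorted s_size t_sorted t_size d_gt0 st_prod le_st le_ts j lt_jn.
have prod0 (u : seq R) : \prod_(i < n) (u`_i - u`_j) = 0.
  by rewrite (bigD1 (Ordinal lt_jn)) //= subrr mul0r.
have prev (u v : seq R) : (forall k, (k.+1 < n)%N -> u`_k <= v`_k.+1) ->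
    (0 < j)%N -> u`_j.-1 <= v`_j.
  by case: j lt_jn {prod0} => // j lt_jn le_uv _; exact: le_uv.
case: ifPn => [j_even|]; [|rewrite negbK => j_odd]; rewrite ltNge; apply/negP => le_j.
  have := sign_between_roots t_sorted t_size lt_jn (prev _ _ le_ts) le_j.
  have := st_prod s`_j; rewrite prod0 => /esym/eqP; rewrite addr_eq0 => /eqP ->.
  by rewrite -signr_odd (negPf j_even) expr0 mul1r oppr_ge0 leNgt d_gt0.
have := sign_between_roots s_sorted s_size lt_jn (prev _ _ le_st) le_j.
by rewrite st_prod prod0 add0r -signr_odd j_odd expr1 mulN1r oppr_ge0 leNgt d_gt0.
Qed.

End Ordering.

(** * The residual as a linear map, and the boundary conditions in coordinates *)

Section ResidualMap.
Variables (R : realType) (N : nat) (f q w : nat -> R) (A B : 'M[R[i]]_2) (lam : R[i]).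

Lemma yat_linear (k : nat) (a : R[i]) (u v : 'rV[R[i]]_N.+2) :
  yat (a *: u + v) k = a * yat u k + yat v k.
Proof. by rewrite /yat !mxE. Qed.

Lemma resid_is_linear : linear (@resid R N f q w A B lam).
Proof.
move=> a u v; apply/rowP => j; rewrite !mxE; case: ifP => _.
  by rewrite /sl_resid /Dy !yat_linear; ring.
rewrite !big_ord_recl !big_ord0 !mxE /= /Dy !yat_linear; ring.
Qed.

HB.instance Definition _ := GRing.isLinear.Build R[i] 'rV[R[i]]_N.+2
  'rV[R[i]]_N.+2 _ (@resid R N f q w A B lam) resid_is_linear.

Lemma resid_kerP (y : 'rV[R[i]]_N.+2) :
  y *m lin1_mx (@resid R N f q w A B lam) = 0 <->
  [/\ forall i, (i < N)%N -> sl_resid f q w lam y i.+1 = 0,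
      bc_resid f A B y 0 0 = 0 & bc_resid f A B y 1 0 = 0].
Proof.
rewrite mul_rV_lin1 /=; split=> [/rowP y0|[eq0 bc0 bc1]].
  split=> [i lt_iN||].
  - have lt_iN2 : (i < N.+2)%N by rewrite (ltn_trans lt_iN) // ltnW.
    by have := y0 (Ordinal lt_iN2); rewrite !mxE /= lt_iN.
  - have lt_N : (N < N.+2)%N by [].
    have := y0 (Ordinal lt_N); rewrite mxE [RHS]mxE /= ltnn subnn.
    by congr (bc_resid _ _ _ _ _ _ = _); apply: val_inj; rewrite /= inordK.
  - have lt_N : (N.+1 < N.+2)%N by [].
    have := y0 (Ordinal lt_N); rewrite mxE [RHS]mxE /= ltnNge leqnSn subSnn.
    by congr (bc_resid _ _ _ _ _ _ = _); apply: val_inj; rewrite /= inordK.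
apply/rowP => j; rewrite mxE [RHS]mxE; case: ifPn => [lt_jN|]; first exact: eq0.
rewrite -leqNgt => le_Nj; have : (j - N < 2)%N by rewrite ltn_subLR // addn2.
case: (j - N)%N => [|[|//]] _.
- by rewrite -[RHS]bc0; congr (bc_resid _ _ _ _ _ _); apply: val_inj; rewrite /= inordK.
- by rewrite -[RHS]bc1; congr (bc_resid _ _ _ _ _ _); apply: val_inj; rewrite /= inordK.
Qed.

End ResidualMap.

Lemma coupled_bcE (R : realType) (N : nat) (f : nat -> R) (M : 'M[R]_2) (z : R[i])
  (y : 'rV[R[i]]_N.+2) (k : 'I_2) :
  bc_resid f (z *: cmx M) (- 1%:M) y k 0 =
  z * ((M k 0)%:C * yat y 0 + (M k 1)%:C * ((f 0)%:C * Dy y 0)) - bvec f y N k 0.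
Proof.
rewrite /bc_resid mulNmx mul1mx mxE [X in _ + X]mxE; congr (_ - _).
rewrite mxE !big_ord_recl big_ord0 /cmx !mxE /= addr0.
rewrite (_ : lift ord0 ord0 = 1); last exact: val_inj.
by ring.
Qed.

Lemma separated_bcE (R : realType) (N : nat) (f : nat -> R) (K : 'M[R]_2) 
  (y : 'rV[R[i]]_N.+2) :
  bc_resid f (UK_A K) (UK_B R) y 0 0 =
    (K 0 0)%:C * yat y 0 + (K 0 1)%:C * ((f 0)%:C * Dy y 0) /\
  bc_resid f (UK_A K) (UK_B R) y 1 0 = yat y N.
Proof.
rewrite /bc_resid !mxE !big_ord_recl !big_ord0 !mxE /= .
rewrite (_ : lift ord0 ord0 = 1); last exact: val_inj.
by split; ring.
Qed.

(** * Jacobi matrices of the difference operator *)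

Lemma sum_pick (V : nmodType) (m k : nat) (F : nat -> V) :
  \sum_(j < m) F j *+ (j == k :> nat) = if (k < m)%N then F k else 0.
Proof.
case: ifPn => [lt_km|]; last first.
  rewrite -leqNgt => le_mk; apply: big1 => j _.
  by rewrite ltn_eqF // (leq_trans (ltn_ord j)).
rewrite (bigD1 (Ordinal lt_km)) //= eqxx mulr1n big1 ?addr0 // => j.
by rewrite -val_eqE /= => /negPf ->.
Qed.

Lemma sum_pick_pred (V : nmodType) (m : nat) (i : 'I_m) (F : nat -> V) :
  \sum_(j < m) F j *+ (i == j.+1 :> nat) = if (0 < i)%N then F i.-1 else 0.
Proof.
case: ifPn => [i_gt0|]; last first.
  by rewrite -eqn0Ngt => /eqP ->; apply: big1.
have <- : (if (i.-1 < m)%N then F i.-1 else 0) = F i.-1.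
  by rewrite (leq_ltn_trans (leq_pred i)).
rewrite -sum_pick; apply: eq_bigr => j _.
by rewrite -{1}(prednK i_gt0) eqSS eq_sym.
Qed.

Section Jacobi.
Variables (R : realType) (f d r : nat -> R).
Local Notation C := R[i].

(** Index [i] stands for the site [i + 1], so [f (i + 1)] couples the indices [i] and [i + 1]. With
    [r] the inverse square roots of the weights, this is the symmetrised operator. *)
Definition jacobi_entry (i j : nat) : R := r i * r j *
  (d i *+ (i == j) - f j *+ (j == i.+1) - f i *+ (i == j.+1)).

Definition jacobi (m : nat) : 'M[C]_m := \matrix_(i, j) (jacobi_entry i j)%:C.

Lemma jacobi_mulE (m : nat) (Y : nat -> C) (i : 'I_m) :
  (\row_(j < m) Y j *m jacobi m) 0 i = (r i)%:C *
    ((d i)%:C * ((r i)%:C * Y i)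
     - (if (i.+1 < m)%N then (f i.+1)%:C * ((r i.+1)%:C * Y i.+1) else 0)
     - (if (0 < i)%N then (f i)%:C * ((r i.-1)%:C * Y i.-1) else 0)).
Proof.
rewrite mxE.
transitivity (\sum_(j < m) (r i)%:C * (((d j)%:C * ((r j)%:C * Y j)) *+ (j == i :> nat)
   - ((f j)%:C * ((r j)%:C * Y j)) *+ (j == i.+1 :> nat)
   - ((f i)%:C * ((r j)%:C * Y j)) *+ (i == j.+1 :> nat))).
  apply: eq_bigr => j _; rewrite !mxE /jacobi_entry rmorphM !rmorphB !rmorphMn /= rmorphM /=.
  have -> : (j == i :> nat) = (j == i) by [].
  by ring.
rewrite -mulr_sumr !sumrB; congr (_ * (_ - _ - _)).
- by rewrite (sum_pick _ _ (fun j => (d j)%:C * ((r j)%:C * Y j))) ltn_ord.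
- exact: (sum_pick _ _ (fun j => (f j)%:C * ((r j)%:C * Y j))).
- exact: (sum_pick_pred _ (fun j => (f i)%:C * ((r j)%:C * Y j))).
Qed.

End Jacobi.

(** * Elimination of the end values through a coupled boundary condition *)

Section Elimination.
Variables (F : fieldType) (m11 m12 m21 m22 f0 z z' : F).
Hypothesis zz' : z * z' = 1.
Hypothesis detM : m11 * m22 - m12 * m21 = 1.
Let c := m11 - f0 * m12.
Hypothesis c_neq0 : c != 0.

(** [D] stands for [f_N Delta y_N]. The hypothesis [detM] reduces the coefficient of [y1] in [D] to
    [f0 / c * z], the mirror image of the coefficient [f0 / c * z'] of [yN] in [f0 * y0]. With [z']
    the conjugate of [z], this makes the reduced matrix Hermitian. *)
Lemma coupled_elim (y0 y1 yN D : F) :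
  z * (m11 * y0 + m12 * (f0 * (y1 - y0))) - yN = 0 ->
  z * (m21 * y0 + m22 * (f0 * (y1 - y0))) - D = 0 ->
  f0 * y0 = f0 / c * (z' * yN) - f0 / c * f0 * m12 * y1 /\
  D = (m21 - f0 * m22) / c * yN + f0 / c * z * y1.
Proof.
move=> /subr0_eq <- /subr0_eq <-; split.
  apply: (mulfI c_neq0).
  have -> : c * (f0 / c * (z' * (z * (m11 * y0 + m12 * (f0 * (y1 - y0)))))
      - f0 / c * f0 * m12 * y1)
   = f0 * ((z * z') * (m11 * y0 + m12 * (f0 * (y1 - y0)))) - f0 * f0 * m12 * y1.
    by field.
  by rewrite zz' /c; ring.
apply: (mulfI c_neq0).
have -> : c * ((m21 - f0 * m22) / c * (z * (m11 * y0 + m12 * (f0 * (y1 - y0))))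
    + f0 / c * z * y1) =
  z * (m21 - f0 * m22) * (m11 * y0 + m12 * (f0 * (y1 - y0))) + f0 * z * y1 * 1.
  by field.
by rewrite -detM /c; ring.
Qed.

Lemma coupled_extend (y1 yN : F) :
  z * (m11 * ((z' * yN - f0 * m12 * y1) / c)
       + m12 * (f0 * (y1 - (z' * yN - f0 * m12 * y1) / c))) - yN = 0.
Proof.
have -> : m11 * ((z' * yN - f0 * m12 * y1) / c)
    + m12 * (f0 * (y1 - (z' * yN - f0 * m12 * y1) / c)) = z' * yN.
  by rewrite /c; field.
by rewrite mulrA zz' mul1r subrr.
Qed.
End Elimination.

(** * Multiplicities as kernel dimensions of Jacobi matrices *)

Lemma rank_kermx_bij (F : fieldType) (m n p q : nat) (A : 'M[F]_(m, p))
    (B : 'M[F]_(n, q)) (L : 'M[F]_(m, n)) :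
  (forall u : 'rV_m, u *m A = 0 -> u *m L *m B = 0) ->
  (forall u : 'rV_m, u *m A = 0 -> u *m L = 0 -> u = 0) ->
  (forall v : 'rV_n, v *m B = 0 -> exists2 u : 'rV_m, u *m A = 0 & u *m L = v) ->
  \rank (kermx A) = \rank (kermx B).
Proof.
move=> AB inj surj.
(* [L] carries the first kernel onto the second; injectivity on it then preserves the rank. *)
have kerA_L : (kermx A *m L :=: kermx B)%MS.
  apply/eqmxP/andP; split; apply/row_subP => i.
    rewrite row_mul sub_kermx; apply/eqP/AB.
    by apply/sub_kermxP; exact: row_sub.
  have [u /sub_kermxP uA <-] := surj (row i (kermx B)) (sub_kermxP (row_sub _ _)).
  exact: submxMr.
rewrite -kerA_L; apply/esym/mxrank_injP; rewrite -submx0.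
apply/rV_subP => u; rewrite sub_capmx => /andP[/sub_kermxP uA /sub_kermxP uL].
by rewrite (inj u) ?sub0mx.
Qed.

Lemma row_mul_deltaE (A : pzRingType) (m p : nat) (u : 'rV[A]_m) (a : 'I_m) (b k : 'I_p) :
  (u *m delta_mx a b) 0 k = u 0 a *+ (k == b).
Proof.
rewrite mxE (bigD1 a) //= mxE eqxx big1 ?addr0 => [|l /negPf ne_l].
  by rewrite /= mulr_natr.
by rewrite mxE ne_l mulr0.
Qed.

Section Reduction.
Variables (R : realType) (n : nat) (f q w : nat -> R) (M : 'M[R]_2).
Local Notation C := R[i].
Local Notation N := n.+2.
Hypothesis f_neq0 : forall k, (k <= N)%N -> f k != 0.
Hypothesis w_gt0 : forall k, (1 <= k <= N)%N -> 0 < w k.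
Hypothesis detM : \det M = 1.

(** The coefficient of [y_0] in [m_11 y_0 + m_12 f_0 (y_1 - y_0)]. *)
Definition lead : R := M 0 0 - f 0 * M 0 1.
Hypothesis lead_neq0 : lead != 0.

Definition wsqrt (i : nat) : R := Num.sqrt (w i.+1).
Definition winv (i : nat) : R := (wsqrt i)^-1.

(* Diagonal coefficients after y_0 and y_(N+1) have been eliminated through the
   boundary condition, which only affects the rows of y_1 and y_N. *)
Definition jdiag (i : nat) : R := q i.+1 + f i
  + (if i == n.+1 then - ((M 1 0 - f 0 * M 1 1) / lead) else f i.+1)
  + (if i == 0 then f 0 / lead * f 0 * M 0 1 else 0).

Definition corner : R := f 0 / lead * (winv 0 * winv n.+1).

(** Vectors act as rows, so the entry in the last row and first column is the effect of [y_N] on the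
    equation at 1, where eliminating [y_0] brings in the conjugate of [z]. *)
Definition periodic (z : C) : 'M[C]_N := jacobi f jdiag winv N
  + (- corner%:C * Num.conj z) *: delta_mx ord_max ord0
  + (- corner%:C * z) *: delta_mx ord0 ord_max.

Lemma wsqrt_gt0 (i : nat) : (i < N)%N -> 0 < wsqrt i.
Proof. by move=> lt_iN; rewrite sqrtr_gt0 w_gt0. Qed.

Lemma wsqrt_neq0 (i : nat) : (i < N)%N -> (wsqrt i)%:C != 0.
Proof. by move=> lt_iN; rewrite fmorph_eq0 gt_eqF ?wsqrt_gt0. Qed.

Lemma winvK (i : nat) (x : C) : (i < N)%N -> (winv i)%:C * ((wsqrt i)%:C * x) = x.
Proof. by move=> lt_iN; rewrite fmorphV mulKf ?wsqrt_neq0. Qed.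

Lemma wsqrtK (i : nat) (x : C) : (i < N)%N -> (wsqrt i)%:C * ((winv i)%:C * x) = x.
Proof. by move=> lt_iN; rewrite fmorphV mulVKf ?wsqrt_neq0. Qed.

Lemma sqr_wsqrt (i : nat) : (i < N)%N -> (wsqrt i)%:C * (wsqrt i)%:C = (w i.+1)%:C.
Proof.
by move=> lt_iN; rewrite -rmorphM -expr2 sqr_sqrtr // ltW // w_gt0.
Qed.

(** Sends [y] to its weighted values at the sites 1 to [m]. The coupled case takes [m = N]; the
    separated case takes [m = N - 1], as there [y_N = 0]. *)
Definition weight_mx (m : nat) : 'M[C]_(N.+2, m) :=
  \matrix_(k, i) ((wsqrt i)%:C *+ (k == i.+1 :> nat)).

Lemma weight_mxE (m : nat) (y : 'rV[C]_N.+2) : (m <= N)%N ->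
  y *m weight_mx m = \row_(i < m) ((wsqrt i)%:C * yat y i.+1).
Proof.
move=> le_mN; apply/rowP => i; rewrite !mxE.
transitivity (\sum_(k < N.+2) ((wsqrt i)%:C * yat y k) *+ (k == i.+1 :> nat)).
  by apply: eq_bigr => k _; rewrite mxE /yat inord_val mulrnAr mulrC.
rewrite (sum_pick _ _ (fun k => (wsqrt i)%:C * yat y k)) ltnS.
by rewrite (leq_trans (ltn_ord i)) // ltnW.
Qed.

Lemma jacobi_weighted (m : nat) (lam : C) (y : 'rV[C]_N.+2) (i : 'I_m) : (m <= N)%N ->
  (wsqrt i)%:C * (y *m weight_mx m *m (jacobi f jdiag winv m - lam%:M)) 0 i =
    (jdiag i)%:C * yat y i.+1
    - (if (i.+1 < m)%N then (f i.+1)%:C * yat y i.+2 else 0)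
    - (if (0 < i)%N then (f i)%:C * yat y i else 0)
    - lam * (w i.+1)%:C * yat y i.+1.
Proof.
move=> le_mN; have lt_iN : (i < N)%N := leq_trans (ltn_ord i) le_mN.
rewrite weight_mxE // mulmxBr mul_mx_scalar mxE [X in _ + X]mxE [X in _ - X]mxE.
rewrite (jacobi_mulE _ _ _ (fun k => (wsqrt k)%:C * yat y k.+1)).
rewrite mulrBr wsqrtK // winvK //; congr (_ - _ - _ - _).
- by case: ifP => // lt_im; rewrite winvK // (leq_trans lt_im).
- by case: ifP => // i_gt0; rewrite winvK prednK // ltnW.
- by rewrite !mxE -sqr_wsqrt //; ring.
Qed.

Definition coupled_bc (z : C) (y : 'rV[C]_N.+2) : Prop :=
  bc_resid f (z *: cmx M) (- 1%:M) y 0 0 = 0 /\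
  bc_resid f (z *: cmx M) (- 1%:M) y 1 0 = 0.

Lemma detME : M 0 0 * M 1 1 - M 0 1 * M 1 0 = 1.
Proof.
rewrite -detM (expand_det_row _ 0) !big_ord_recl big_ord0 /cofactor !det_mx11 !mxE /=.
have -> : lift ord0 ord0 = 1 :> 'I_2 by apply: val_inj.
have -> : lift 1 0 = 0 :> 'I_2 by apply: val_inj.
by rewrite /= expr0 expr1; ring.
Qed.

Lemma detMC : (M 0 0)%:C * (M 1 1)%:C - (M 0 1)%:C * (M 1 0)%:C = 1.
Proof. by rewrite -!rmorphM -rmorphB detME. Qed.

Lemma leadC : lead%:C = (M 0 0)%:C - (f 0)%:C * (M 0 1)%:C.
Proof. by rewrite rmorphB rmorphM. Qed.

Lemma leadC_neq0 : (M 0 0)%:C - (f 0)%:C * (M 0 1)%:C != 0.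
Proof. by rewrite -leadC fmorph_eq0. Qed.

(** Interior equations agree term by term. In the first and last ones, the eliminated forms of
    [f_0 y_0] and [f_N Delta y_N] supply the corners and the corrections in [jdiag]. *)
Lemma sl_resid_periodic (z lam : C) (y : 'rV[C]_N.+2) (i : 'I_N) :
  z * Num.conj z = 1 -> coupled_bc z y ->
  sl_resid f q w lam y i.+1 =
  (wsqrt i)%:C * (y *m weight_mx N *m (periodic z - lam%:M)) 0 i.
Proof.
move=> zz [bc0 bc1].
have [] := coupled_elim zz detMC leadC_neq0 (y0 := yat y 0) (y1 := yat y 1)
  (yN := yat y N) (D := (f N)%:C * Dy y N).
- by move: bc0; rewrite coupled_bcE mxE.
- by move: bc1; rewrite coupled_bcE mxE.
rewrite -leadC => e0 eN.
set u := y *m weight_mx N.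
have -> : periodic z - lam%:M = (jacobi f jdiag winv N - lam%:M)
  + (- corner%:C * Num.conj z) *: delta_mx ord_max ord0
  + (- corner%:C * z) *: delta_mx ord0 ord_max.
  by rewrite /periodic addrAC [_ + _ *: _ - _]addrAC.
rewrite 2!mulmxDr mxE [X in X + _]mxE -!scalemxAr !mulrDr /u jacobi_weighted // -/u.
have uE k : u 0 k = (wsqrt k)%:C * yat y k.+1 by rewrite /u weight_mxE // mxE.
rewrite [X in _ + _ * X + _]mxE row_mul_deltaE [X in _ + _ * X]mxE row_mul_deltaE !uE /=.
rewrite /sl_resid /Dy /=.
(* The weights inside [corner] cancel the square roots at both ends, leaving the bare coupling
   [f_0 / lead]. *)
have corner_w x : (wsqrt 0)%:C * (- corner%:C * x * (wsqrt n.+1)%:C) =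
    - ((f 0)%:C / lead%:C * x).
  rewrite /corner !rmorphM fmorphV /=.
  rewrite -[in RHS](winvK x (ltnSn n.+1)) -[in RHS](winvK ((winv _)%:C * _) (ltn0Sn n.+1)).
  by ring.
have [i0|i_gt0] := posnP i.
  have -> : i = ord0 by apply: val_inj.
  rewrite /= mulr1n mulr0n !mulr0 addr0 subr0.
  have -> : (wsqrt 0)%:C * (- corner%:C * Num.conj z * ((wsqrt n.+1)%:C * yat y N)) =
     - ((f 0)%:C / lead%:C * Num.conj z) * yat y N by rewrite -corner_w; ring.
  transitivity ((q 1 + f 0 + f 1)%:C * yat y 1 - (f 1)%:C * yat y 2
    - (f 0)%:C * yat y 0 - lam * (w 1)%:C * yat y 1); first by ring.
  by rewrite e0 /jdiag /=; move: lead => l; rewrite !rmorphD !rmorphM fmorphV /=; ring.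
have ne_i0 : (i == ord0) = false by rewrite -val_eqE /= gtn_eqF.
have [iN|ne_iN] := eqVneq (i : nat) n.+1.
  have -> : i = ord_max by apply: val_inj.
  rewrite /= ltnn eqxx mulr1n mulr0n !mulr0 addr0 subr0.
  have -> : (wsqrt n.+1)%:C * (- corner%:C * z * ((wsqrt 0)%:C * yat y 1)) =
     - ((f 0)%:C / lead%:C * z) * yat y 1 by rewrite -corner_w; ring.
  transitivity ((q n.+2 + f n.+1)%:C * yat y n.+2 - (f N)%:C * Dy y N
    - (f n.+1)%:C * yat y n.+1 - lam * (w n.+2)%:C * yat y n.+2).
    by rewrite /Dy; ring.
  rewrite eN /jdiag eqxx /= addr0; move: lead => l.
  rewrite !rmorphD rmorphN !rmorphM fmorphV rmorphB rmorphM /=.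
  by ring.
have ne_imax : (i == ord_max) = false by rewrite -val_eqE /= (negPf ne_iN).
rewrite ne_i0 ne_imax !mulr0n !mulr0 !addr0.
have -> : (i.+1 < N)%N by rewrite ltnS ltn_neqAle ne_iN -ltnS ltn_ord.
rewrite /jdiag (negPf ne_iN) gtn_eqF // addr0.
by ring.
Qed.

(** A right inverse of weighting, with prescribed end values. The default 0 past site [m + 1] builds
    in [y_N = 0] when [m = n]. *)
Definition extend (m : nat) (v : 'rV[C]_m.+1) (y0 yL : C) : 'rV[C]_N.+2 :=
  \row_k (if k == 0 :> nat then y0 else if k == N.+1 :> nat then yL
          else if (k <= m.+1)%N then (winv k.-1)%:C * v 0 (inord k.-1) else 0).

Section Extend.
Variables (m : nat) (v : 'rV[C]_m.+1) (y0 yL : C).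
Hypothesis le_mN : (m < N)%N.

Lemma extend_first : yat (extend v y0 yL) 0 = y0.
Proof. by rewrite /yat mxE inordK. Qed.

Lemma extend_last : yat (extend v y0 yL) N.+1 = yL.
Proof. by rewrite /yat mxE inordK //= eqxx. Qed.

Lemma extend_mid (k : nat) : (k < m.+1)%N ->
  yat (extend v y0 yL) k.+1 = (winv k)%:C * v 0 (inord k).
Proof.
move=> lt_km; have lt_kN : (k < N)%N := leq_trans lt_km le_mN.
rewrite /yat mxE inordK /=; last by rewrite ltnS (ltn_trans lt_kN).
by rewrite eqSS ltn_eqF // lt_km.
Qed.

Lemma extend_out (k : nat) : (m < k < N)%N -> yat (extend v y0 yL) k.+1 = 0.
Proof.
move=> /andP[lt_mk lt_kN].
rewrite /yat mxE inordK /=; last by rewrite ltnS (ltn_trans lt_kN).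
by rewrite eqSS ltn_eqF // ltnNge lt_mk.
Qed.

Lemma extend_weight : extend v y0 yL *m weight_mx m.+1 = v.
Proof.
rewrite weight_mxE //; apply/rowP => i; rewrite mxE extend_mid //.
by rewrite wsqrtK ?inord_val // (leq_trans (ltn_ord i)).
Qed.
End Extend.

Lemma weight_eq0 (m : nat) (y : 'rV[C]_N.+2) (k : nat) : (m <= N)%N ->
  y *m weight_mx m = 0 -> (k < m)%N -> yat y k.+1 = 0.
Proof.
move=> le_mN y0 lt_km; have := congr1 (fun u : 'rV_m => u 0 (Ordinal lt_km)) y0.
rewrite weight_mxE // !mxE /= => /eqP; rewrite mulf_eq0 => /orP[|/eqP //].
by rewrite (negPf (wsqrt_neq0 (leq_trans lt_km le_mN))).
Qed.

Lemma row_eq0_yat (y : 'rV[C]_N.+2) : yat y 0 = 0 -> yat y N.+1 = 0 ->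
  (forall k, (k < N)%N -> yat y k.+1 = 0) -> y = 0.
Proof.
move=> y0 yL ymid; apply/rowP => k; rewrite mxE.
have -> : y 0 k = yat y k by rewrite /yat inord_val.
case: k => -[|k] //= lt_k; have [->//|ne_kN] := eqVneq k N.
by apply: ymid; rewrite ltn_neqAle ne_kN -ltnS.
Qed.

Lemma fN_neq0 : (f N)%:C != 0.
Proof. by rewrite fmorph_eq0 f_neq0. Qed.

(** Weighting is bijective on solutions: as [lead] and [f_N] are nonzero, the two boundary rows
    recover [y_0] and [y_(N+1)]. *)
Lemma mult_coupled (z lam : C) : z * Num.conj z = 1 ->
  mult N f q w (z *: cmx M) (- 1%:M) lam = \rank (kermx (periodic z - lam%:M)).
Proof.
move=> zz; have z_neq0 : z != 0.
  by apply/eqP => z0; move/eqP: zz; rewrite z0 mul0r eq_sym oner_eq0.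
apply: (rank_kermx_bij (L := weight_mx N)) => [y|y|v vker].
- move=> /resid_kerP[eqs bc0 bc1]; apply/rowP => i; rewrite [RHS]mxE.
  apply: (mulfI (wsqrt_neq0 (ltn_ord i))).
  by rewrite mulr0 -sl_resid_periodic // eqs.
- move=> /resid_kerP[_]; rewrite !coupled_bcE !mxE /= => bc0 bc1 yw.
  have ymid := weight_eq0 (leqnn N) yw.
  have y0 : yat y 0 = 0.
    move: bc0; rewrite /Dy !ymid // subr0 sub0r => /eqP.
    rewrite mulf_eq0 (negPf z_neq0) /= mulrN mulrN mulrA [X in _ - X * _]mulrC -mulrBl.
    by rewrite mulf_eq0 (negPf leadC_neq0) /= => /eqP.
  apply: row_eq0_yat => //; move: bc1; rewrite /Dy y0 (ymid 0%N) // (ymid n.+1) //.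
  rewrite !subr0 !mulr0 addr0 mulr0 sub0r.
  by move/eqP; rewrite oppr_eq0 mulf_eq0 (negPf fN_neq0) /= => /eqP.
pose y1 := (winv 0)%:C * v 0 (inord 0).
pose yN := (winv n.+1)%:C * v 0 (inord n.+1).
(* [y0] solves the first boundary row; [D] is the value of [f_N Delta y_N] demanded by the second,
   which fixes the last entry of [y]. *)
pose y0 := (Num.conj z * yN - (f 0)%:C * (M 0 1)%:C * y1) / lead%:C.
pose D := z * ((M 1 0)%:C * y0 + (M 1 1)%:C * ((f 0)%:C * (y1 - y0))).
pose y := extend v y0 (yN + D / (f N)%:C).
have yE0 : yat y 0 = y0 by rewrite extend_first.
have yE1 : yat y 1 = y1 by rewrite extend_mid.
have yEN : yat y N = yN by rewrite extend_mid.
have yEL : yat y N.+1 = yN + D / (f N)%:C by rewrite extend_last.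
have bc : coupled_bc z y.
  split; rewrite coupled_bcE mxE /= /Dy yE0 yE1 yEN.
    by rewrite /y0 leadC; apply: coupled_extend => //; exact: leadC_neq0.
  by rewrite yEL addrAC subrr add0r [(f N)%:C * _]mulrC divfK ?fN_neq0 // /D subrr.
exists y; last exact: extend_weight.
apply/resid_kerP; case: (bc) => bc0 bc1; split => // i lt_iN.
have -> := @sl_resid_periodic z lam y (Ordinal lt_iN) zz bc.
by rewrite extend_weight // vker mxE mulr0.
Qed.

(** Solving the first condition for [y_0] gives the same correction at index 0 as in the coupled
    case, with no corner term. *)
Lemma sl_resid_separated (lam : C) (y : 'rV[C]_N.+2) (i : 'I_n.+1) :
  (M 0 0)%:C * yat y 0 + (M 0 1)%:C * ((f 0)%:C * Dy y 0) = 0 -> yat y N = 0 ->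
  sl_resid f q w lam y i.+1 =
  (wsqrt i)%:C * (y *m weight_mx n.+1 *m (jacobi f jdiag winv n.+1 - lam%:M)) 0 i.
Proof.
move=> bc0 yN.
have e0 : (f 0)%:C * yat y 0 = - ((f 0)%:C / lead%:C * (f 0)%:C * (M 0 1)%:C * yat y 1).
  have l0 : lead%:C * yat y 0 = - ((f 0)%:C * (M 0 1)%:C * yat y 1).
    by apply/eqP; rewrite -addr_eq0 leadC -[X in _ == X]bc0 /Dy; apply/eqP; ring.
  have lC : lead%:C != 0 by rewrite fmorph_eq0.
  by apply: (mulfI lC); rewrite mulrCA l0; field.
rewrite jacobi_weighted // /sl_resid /Dy /=.
(* The last row has the neighbour [y_N = 0], so cutting the matrix off there loses nothing. *)
have next : (if (i.+1 < n.+1)%N then (f i.+1)%:C * yat y i.+2 else 0) =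
    (f i.+1)%:C * yat y i.+2.
  case: ifPn => //; rewrite -leqNgt ltnS => le_ni.
  have -> : i.+2 = N by apply/eqP; rewrite !eqSS eqn_leq le_ni -ltnS ltn_ord.
  by rewrite yN mulr0.
rewrite next /jdiag ltn_eqF //.
have [i0|i_gt0] := posnP i.
  have -> : i = ord0 by apply: val_inj.
  transitivity ((q 1 + f 0 + f 1)%:C * yat y 1 - (f 1)%:C * yat y 2
    - (f 0)%:C * yat y 0 - lam * (w 1)%:C * yat y 1); first by rewrite /=; ring.
  rewrite e0 /=; move: lead => l; rewrite !rmorphD !rmorphM fmorphV /=; ring.
rewrite addr0; ring.
Qed.

(** The matrix encodes the first [N - 1] equations; the one at [n = N] determines [y_(N+1)]. Passing
    from [K] to [-K] only changes the sign of a boundary row. *)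
Lemma mult_separated (K : 'M[R]_2) (lam : C) : (M = K \/ M = - K) ->
  mult N f q w (UK_A K) (UK_B R) lam =
  \rank (kermx (jacobi f jdiag winv n.+1 - lam%:M)).
Proof.
move=> MK.
have bcP (y : 'rV[C]_N.+2) : bc_resid f (UK_A K) (UK_B R) y 0 0 = 0 <->
    (M 0 0)%:C * yat y 0 + (M 0 1)%:C * ((f 0)%:C * Dy y 0) = 0.
  have [-> _] := separated_bcE f K y; case: MK => -> //.
  rewrite !mxE !rmorphN !mulNr -opprD; split => [->|/eqP]; first by rewrite oppr0.
  by rewrite oppr_eq0 => /eqP.
have bcNE (y : 'rV[C]_N.+2) := (separated_bcE f K y).2.
apply: (rank_kermx_bij (L := weight_mx n.+1)) => [y|y|v vker].
- move=> /resid_kerP[eqs /bcP bc0]; rewrite bcNE => bcN; apply/rowP => i; rewrite [RHS]mxE.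
  have lt_iN : (i < N)%N by rewrite ltnS ltnW.
  apply: (mulfI (wsqrt_neq0 lt_iN)).
  by rewrite mulr0 -sl_resid_separated // eqs.
- move=> /resid_kerP[eqs /bcP bc0]; rewrite bcNE => bcN yw.
  have ymid k : (k < N)%N -> yat y k.+1 = 0.
    rewrite ltnS leq_eqVlt => /orP[/eqP -> //|].
    exact: (weight_eq0 (leqnSn n.+1) yw).
  apply: row_eq0_yat => //.
    move: bc0; rewrite /Dy !ymid // sub0r => /eqP.
    rewrite mulrN mulrN mulrA [X in _ - X * _]mulrC -mulrBl.
    by rewrite mulf_eq0 (negPf leadC_neq0) /= => /eqP.
  (* With [y_N] and [y_(N-1)] zero, the equation at [n = N] reduces to [f_N y_(N+1) = 0]. *)
  move: (eqs n.+1 (ltnSn _)); rewrite /sl_resid /Dy /= (ymid n.+1) // (ymid n) //.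
  rewrite !(subr0, mulr0, addr0) => /eqP.
  by rewrite oppr_eq0 mulf_eq0 (negPf fN_neq0) /= => /eqP.
pose y1 := (winv 0)%:C * v 0 (inord 0).
pose y0 := - ((f 0)%:C * (M 0 1)%:C * y1) / lead%:C.
pose yn := (winv n)%:C * v 0 (inord n).
(* The last value is the one forced by the equation at [n = N] when [y_N = 0]. *)
pose y := extend v y0 (- ((f n.+1)%:C * yn) / (f N)%:C).
have yE0 : yat y 0 = y0 by rewrite extend_first.
have yE1 : yat y 1 = y1 by rewrite extend_mid.
have yEn : yat y n.+1 = yn by rewrite extend_mid.
have yEN : yat y N = 0 by apply: extend_out; rewrite !ltnSn.
have yEL : yat y N.+1 = - ((f n.+1)%:C * yn) / (f N)%:C by rewrite extend_last.
have bc0 : (M 0 0)%:C * yat y 0 + (M 0 1)%:C * ((f 0)%:C * Dy y 0) = 0.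
  by rewrite /Dy yE0 yE1 /y0 leadC; field; rewrite leadC_neq0.
exists y; last exact: extend_weight.
apply/resid_kerP; split=> [i||]; [|exact: (bcP y).2|by rewrite bcNE].
rewrite ltnS leq_eqVlt => /orP[/eqP ->|lt_in].
  rewrite /sl_resid /Dy /= yEN yEL yEn; field; exact: fN_neq0.
have -> := @sl_resid_separated lam y (Ordinal lt_in) bc0 yEN.
by rewrite extend_weight // vker mxE mulr0.
Qed.

End Reduction.

(** * Spectra of the reduced matrices and dependence of the determinant on [z] *)

Section SpectralData.
Variables (R : realType) (n : nat) (f q w : nat -> R) (M : 'M[R]_2).
Local Notation C := R[i].
Local Notation N := n.+2.
Hypothesis f_neq0 : forall k, (k <= N)%N -> f k != 0.
Hypothesis w_gt0 : forall k, (1 <= k <= N)%N -> 0 < w k.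
Hypothesis detM : \det M = 1.
Hypothesis prod_gt0 : 0 < \prod_(i < N) (f i)^-1.
Hypothesis lead_gt0 : 0 < M 0 0 - f 0 * M 0 1.

Local Notation jac := (jacobi f (jdiag n f q M) (winv w)).
Local Notation per := (periodic n f q w M).
Let lead_neq0 : lead f M != 0. Proof. by rewrite gt_eqF. Qed.

Lemma jacobi_entry_sym (d r : nat -> R) (i j : nat) :
  jacobi_entry f d r i j = jacobi_entry f d r j i.
Proof.
rewrite /jacobi_entry [r i * _]mulrC; congr (_ * _).
by rewrite [j == i]eq_sym; case: eqP => [->|_] //; rewrite addrAC.
Qed.

Lemma conjC_real (x : R) : Num.conj x%:C = x%:C.
Proof. exact: conjc_real. Qed.

Lemma jacobi_hermitian (m : nat) (i j : 'I_m) : jac m i j = Num.conj (jac m j i).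
Proof. by rewrite !mxE conjC_real jacobi_entry_sym. Qed.

Lemma periodic_hermitian (z : C) (i j : 'I_N) : per z i j = Num.conj (per z j i).
Proof.
rewrite !mxE jacobi_entry_sym; move: (corner _ _ _ _) (jacobi_entry _ _ _ _ _) => k a.
rewrite !(rmorphD, rmorphM, rmorphN, rmorph_nat) /= !conjC_real conjCK.
by rewrite ![(j == _) && _]andbC addrAC.
Qed.

(** Both corners lie in the last row or column, which the submatrix omits. *)
Lemma jacobi_periodic_sub (z : C) (i j : 'I_n.+1) :
  jac n.+1 i j = per z (widen_ord (leqnSn n.+1) i) (widen_ord (leqnSn n.+1) j).
Proof.
have ne_max (k : 'I_n.+1) : (widen_ord (leqnSn n.+1) k == ord_max) = false.
  by rewrite -val_eqE /= ltn_eqF.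
by rewrite !mxE !ne_max andbF !mulr0 !addr0.
Qed.

(** For [z] of modulus 1, [det (H_z - x)] depends on [z] only through [- 2 * gap * Re z]. *)
Definition gap : R := corner n f w M *
  \prod_(i < n.+1) (winv w i * winv w i.+1 * f i.+1).

(** The factor [f_0] of [corner] completes the product of [f_1] to [f_(N-1)]; all remaining factors
    are positive. *)
Lemma gap_gt0 : 0 < gap.
Proof.
have r_gt0 i : (i < N)%N -> 0 < winv w i by move=> lt_iN; rewrite invr_gt0 (wsqrt_gt0 w_gt0).
have -> : gap = \prod_(i < N) f i * ((lead f M)^-1 * (winv w 0 * winv w n.+1)
    * \prod_(i < n.+1) (winv w i * winv w i.+1)).
  rewrite /gap /corner big_split /= [in RHS]big_ord_recl /=.
  by under [in RHS]eq_bigr do rewrite /bump leq0n add1n; ring.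
rewrite mulr_gt0 //; first by rewrite -invr_gt0 -prodfV.
rewrite !mulr_gt0 ?r_gt0 ?invr_gt0 //.
apply: prodr_gt0 => i _; have lt_in := ltn_ord i.
by rewrite mulr_gt0 ?r_gt0 // (leq_trans lt_in).
Qed.

(** The two corners have sum [- 2 * corner * Re z] and product [corner ^+ 2], so only the term
    linear in the corners varies with [z]. *)
Lemma det_periodic_diff (x : R) (z1 z2 : C) :
  z1 * Num.conj z1 = 1 -> z2 * Num.conj z2 = 1 ->
  \det (per z1 - (x%:C)%:M) = \det (per z2 - (x%:C)%:M)
    + (gap * (2 * (complex.Re z2 - complex.Re z1)))%:C.
Proof.
move=> zz1 zz2; pose T := jac N - (x%:C)%:M.
have T_sym i j : T i j = T j i.
  by rewrite !mxE jacobi_entry_sym [j == i]eq_sym.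
have T_band (i j : 'I_N) : (i.+1 < j)%N -> T i j = 0.
  move=> lt_ij; rewrite !mxE /jacobi_entry -!val_eqE /=.
  have lt_ij' := ltnW lt_ij.
  by rewrite (ltn_eqF lt_ij') (gtn_eqF lt_ij) (ltn_eqF (leqW lt_ij')) /= !mulr0n !subr0 mulr0.
have off : offdiag_prod T = (\prod_(i < n.+1) (winv w i * winv w i.+1 * f i.+1))%:C.
  rewrite rmorph_prod; apply: eq_bigr => i _.
  rewrite !mxE /jacobi_entry -!val_eqE /= /bump leq0n add1n.
  by rewrite (ltn_eqF (ltnSn i)) eqxx (ltn_eqF (leqW (ltnSn i))) /= !mulr0n mulr1n; ring.
have [e detE] := det_periodic_jacobi T_sym T_band.
have perE z : per z - (x%:C)%:M = T
  + (- (corner n f w M)%:C * Num.conj z) *: delta_mx ord_max ord0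
  + (- (corner n f w M)%:C * z) *: delta_mx ord0 ord_max.
  by rewrite /periodic addrAC [_ + _ *: _ - _]addrAC.
have perD z : z * Num.conj z = 1 -> \det (per z - (x%:C)%:M) = \det T
    - (gap * (2 * complex.Re z))%:C + ((corner n f w M)%:C) ^+ 2 * e.
  move=> zz; rewrite perE detE off /gap.
  (* The modulus condition enters by replacing this 1 with [z] times its conjugate; a polynomial
     identity remains. *)
  have -> : (corner n f w M)%:C ^+ 2 = (corner n f w M)%:C ^+ 2 * 1 by rewrite mulr1.
  rewrite -zz !rmorphM rmorph_nat -addcJ /=.
  have -> : (z^*)%C = Num.conj z by [].
  by ring.
by rewrite !perD //; ring.
Qed.

(** The list [s'] is chosen before [z]: a common interlacing list is what links the spectra for
    different [z]. *)
Lemma separated_spectrum (K : 'M[R]_2) : (M = K \/ M = - K) ->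
  exists s', [/\ ev_list N f q w (UK_A K) (UK_B R) s', size s' = n.+1 &
   forall z : C, z * Num.conj z = 1 -> exists s,
     [/\ ev_list N f q w (z *: cmx M) (- 1%:M) s, size s = N,
      forall x : R, (\prod_(i < N) (s`_i - x))%:C = \det (per z - (x%:C)%:M) &
      forall j, (j.+1 < N)%N -> s`_j <= s'`_j <= s`_j.+1]].
Proof.
move=> MK.
have [s' [U' [s'_sorted s'_size U'u eS']]] := hermitian_spectrum (@jacobi_hermitian n.+1).
exists s'; split=> // [|z zz].
  split=> // lam; rewrite (mult_separated q f_neq0 w_gt0 lead_neq0) //.
  exact: (count_spectrum s'_size U'u eS').
have [s [U [s_sorted s_size Uu eS]]] := hermitian_spectrum (periodic_hermitian z).
exists s; split=> //.
- split=> // lam; rewrite (mult_coupled q f_neq0 w_gt0 detM lead_neq0) //.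
  exact: (count_spectrum s_size Uu eS).
- move=> x; rewrite (det_spectrum Uu eS) rmorph_prod.
  by apply: eq_bigr => i _; rewrite rmorphB.
move=> j; rewrite ltnS => lt_jn; apply/andP; split.
  exact: (cauchy_interlacing_lower s_size s'_size s_sorted s'_sorted Uu U'u eS eS'
    (jacobi_periodic_sub z)).
exact: (cauchy_interlacing_upper s_size s'_size s_sorted s'_sorted Uu U'u eS eS'
    (jacobi_periodic_sub z)).
Qed.

End SpectralData.

(** * Unimodular factors and comparison of the three coupled spectra *)

Lemma expi_mul_conj (R : realType) (g : R) : expi g * Num.conj (expi g) = 1.
Proof.
have -> : expi g = cos g +i* sin g by rewrite /expi; simpc.
apply/eqP; rewrite eq_complex; apply/andP; split; apply/eqP => /=; last by ring.
by rewrite -(cos2Dsin2 g); ring.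
Qed.

Lemma Re_expi (R : realType) (g : R) : complex.Re (expi g) = cos g.
Proof. by rewrite /expi; simpc. Qed.

(** Cosine decreases strictly from 1 to -1 on [[0, pi]], and evenness covers negative angles. *)
Lemma cos_strict_bounds (R : realType) (g : R) :
  (- pi < g < 0) || (0 < g < pi) -> -1 < cos g < 1.
Proof.
suff cos_pos (x : R) : 0 < x < pi -> -1 < cos x < 1.
  by case/orP => gpi; [rewrite -cosN cos_pos // oppr_gt0 ltrNl andbC|exact: cos_pos].
move=> /andP[x_gt0 x_lt].
have x_itv : x \in `[0, pi] by rewrite in_itv /= !ltW.
by apply/andP; split; [rewrite -cospi|rewrite -cos0];
  rewrite ltr_cos ?in_itv //= lexx pi_ge0.
Qed.

Unset Implicit Arguments.

Theorem theorem3p9 (R : realType) (N : nat) (f q w : nat -> R)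
  (K M : 'M[R]_2) (gamma : R) :
  (2 <= N)%N ->
  (forall n, (n <= N)%N -> f n != 0) ->
  (forall n, (1 <= n <= N)%N -> 0 < w n) ->
  0 < \prod_(i < N) (f i)^-1 ->
  (- pi < gamma < 0) || (0 < gamma < pi) ->
  \det K = 1 ->
  K 0 0 - f 0 * K 0 1 != 0 ->
  (M = K \/ M = - K) ->
  0 < M 0 0 - f 0 * M 0 1 ->
  exists sM sNM sG sU : seq R,
    [/\ ev_list N f q w (cmx M) (- 1%:M) sM,
        ev_list N f q w (cmx (- M)) (- 1%:M) sNM,
        ev_list N f q w (expi gamma *: cmx M) (- 1%:M) sG
      & ev_list N f q w (UK_A K) (UK_B R) sU] /\
    [/\ (N <= size sM)%N, (N <= size sNM)%N, (N <= size sG)%N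
      & (N.-1 <= size sU)%N] /\
    (forall j, (j < N)%N ->
       if ~~ odd j then sM`_j < sG`_j < sNM`_j
       else sNM`_j < sG`_j < sM`_j) /\
    (forall j, (j.+1 < N)%N ->
       Num.max sM`_j sNM`_j <= sU`_j <= Num.min sM`_j.+1 sNM`_j.+1).
Proof.
case: N => [|[|n]] // _ f_neq0 w_gt0 prod_gt0 gamma_range detK _ MK lead_gt0.
have detM : \det M = 1.
  by case: MK => -> //; rewrite -scaleN1r detZ sqrrN expr1n mul1r.
have [sU [evU sizeU spec]] := separated_spectrum q f_neq0 w_gt0 detM lead_gt0 MK.
(* The coupled conditions are the cases [z = 1], [z = -1] and [z = e^(i gamma)] of one family for
   the single matrix [M]. *)
have zzP : (1 : R[i]) * Num.conj 1 = 1 by rewrite conjC1 mulr1.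
have zzN : (-1 : R[i]) * Num.conj (-1) = 1 by rewrite rmorphN1 mulrNN mulr1.
have zzG := expi_mul_conj gamma.
have [sM [evM sizeM prodM interM]] := spec _ zzP.
have [sNM [evNM sizeNM prodNM interNM]] := spec _ zzN.
have [sG [evG sizeG prodG interG]] := spec _ zzG.
(* A larger real part lowers the determinant by a positive constant, hence gives smaller eigenvalues
   at even indices and larger ones at odd indices. *)
have order (z1 z2 : R[i]) (s t : seq R) :
  z1 * Num.conj z1 = 1 -> z2 * Num.conj z2 = 1 ->
  sorted <=%R s -> size s = n.+2 -> sorted <=%R t -> size t = n.+2 ->
  (forall x : R, (\prod_(i < n.+2) (s`_i - x))%:C =
     \det (periodic n f q w M z1 - (x%:C)%:M)) ->
  (forall x : R, (\prod_(i < n.+2) (t`_i - x))%:C =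
     \det (periodic n f q w M z2 - (x%:C)%:M)) ->
  (forall j, (j.+1 < n.+2)%N -> s`_j <= sU`_j <= s`_j.+1) ->
  (forall j, (j.+1 < n.+2)%N -> t`_j <= sU`_j <= t`_j.+1) ->
  complex.Re z1 < complex.Re z2 ->
  forall j, (j < n.+2)%N -> if ~~ odd j then t`_j < s`_j else s`_j < t`_j.
  move=> zz1 zz2 s_sorted s_size t_sorted t_size s_prod t_prod s_inter t_inter lt_z.
  apply: (@alternating_roots _ n.+2 s t
    (gap n f w M * (2 * (complex.Re z2 - complex.Re z1)))) => //.
  - apply: mulr_gt0; last by rewrite mulr_gt0 ?subr_gt0.
    exact: (gap_gt0 w_gt0 prod_gt0 lead_gt0).
  - move=> x; apply: (@complexI R).
    by rewrite s_prod (det_periodic_diff n f q w M x zz1 zz2) rmorphD /= t_prod.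
  - move=> j lt_j; have /andP[le1 _] := s_inter j lt_j.
    by have /andP[_ le2] := t_inter j lt_j; exact: le_trans le1 le2.
  - move=> j lt_j; have /andP[le1 _] := t_inter j lt_j.
    by have /andP[_ le2] := s_inter j lt_j; exact: le_trans le1 le2.
have /andP[cos_gtN1 cos_lt1] := cos_strict_bounds gamma_range.
exists sM, sNM, sG, sU; split; last split; last split.
- rewrite scale1r in evM.
  have -> : cmx (- M) = -1 *: cmx M.
    by apply/matrixP => i j; rewrite !mxE rmorphN mulN1r.
  by split; [exact: evM|exact: evNM|exact: evG|exact: evU].
- by rewrite sizeM sizeNM sizeG sizeU.
- move=> j lt_j.
  (* Since [-1 < cos gamma < 1], two comparisons place the spectrum for [e^(i gamma)] strictly
     between the other two. *)
  have := order _ _ _ _ zzG zzP evG.1 sizeG evM.1 sizeM prodG prodM interG interM.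
  rewrite Re_expi /= => /(_ cos_lt1 j lt_j).
  have := order _ _ _ _ zzN zzG evNM.1 sizeNM evG.1 sizeG prodNM prodG interNM interG.
  rewrite Re_expi /= => /(_ cos_gtN1 j lt_j).
  by case: ifP => _ -> ->.
move=> j lt_j; have /andP[le1 le2] := interM j lt_j.
by have /andP[le3 le4] := interNM j lt_j; rewrite ge_max le_min le1 le2 le3 le4.
Qed.
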